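(* Let $\ell\ge5$ be a prime number and let $t=3$. Then $$\mathrm{Prob}_\ell(X_3;\mu=0,\lambda=1)=\frac{\ell^2}{\ell^2+\ell+1}.$$ If $\ell\equiv2\pmod3$, then $$\mathrm{Prob}_\ell(X_3;\mu=\mu_0,\lambda=\lambda_0)=\begin{cases}\frac{\ell^2}{\ell^2+\ell+1}&\text{if }\mu_0=0\text{ and }\lambda_0=1,\\ \frac{\ell+1}{\ell^2+\ell+1}&\text{if }\mu_0=0\text{ and }\lambda_0=3,\\ 0&\text{otherwise.}\end{cases}$$ If $\ell\equiv1\pmod3$, then $$\mathrm{Prob}_\ell(X_3;\mu=\mu_0,\lambda=\lambda_0)=\begin{cases}\frac{\ell^2}{\ell^2+\ell+1}&\text{if }\mu_0=0\text{ and }\lambda_0=1,\\ \frac{\ell-7}{\ell^2+\ell+1}&\text{if }\mu_0=0\text{ and }\lambda_0=3,\\ \frac{8}{\ell^2+\ell+1}&\text{if }\mu_0=0\text{ and }\lambda_0=5,\\ 0&\text{otherwise.}\end{cases}$$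
   Context: For $b\in\mathbb{Z}_\ell$ put $\binom{b}{n}=\frac{b(b-1)\cdots(b-n+1)}{n!}\in\mathbb{Z}_\ell$ and $(1+T)^b=\sum_{n\ge0}\binom{b}{n}T^n\in\mathbb{Z}_\ell[[T]]$. The bouquet $X_t$ is the multigraph with one vertex and $t$ undirected loops; a vector $\alpha=(\alpha_1,\dots,\alpha_t)\in\mathbb{Z}_\ell^t$ assigns the voltage $\alpha_j$ to the $j$-th loop. It is admissible if $\alpha\in\mathbb{Z}_\ell^t\setminus(\ell\mathbb{Z}_\ell)^t$. The characteristic series is $$f(T)=f_{X_t,\alpha}(T)=\sum_{j=1}^t\big(2-(1+T)^{\alpha_j}-(1+T)^{-\alpha_j}\big)\in\mathbb{Z}_\ell[[T]].$$ For admissible $\alpha$ it is nonzero, and it has zero constant term. By Weierstrass preparation write $f(T)=\ell^{\mu}g(T)u(T)$ with $\mu\in\mathbb{Z}_{\ge0}$, $g$ a distinguished polynomial (monic, all non-leading coefficients divisible by $\ell$) and $u\in\mathbb{Z}_\ell[[T]]^\times$. Then $\mu_\ell(X_t,\alpha):=\mu$ and $\lambda_\ell(X_t,\alpha):=\deg g-1$ (note the shift by $-1$). Let $\tau$ be the Haar measure on $\mathbb{Z}_\ell^t$ normalized by $\tau(\mathbb{Z}_\ell^t)=1$, so $\tau(\mathbb{Z}_\ell^t\setminus(\ell\mathbb{Z}_\ell)^t)=1-\ell^{-t}$. Define $$\mathrm{Prob}_\ell(X_t;\mu=\mu_0,\lambda=\lambda_0)=(1-\ell^{-t})^{-1}\,\tau\big(\{\alpha\in\mathbb{Z}_\ell^t\setminus(\ell\mathbb{Z}_\ell)^t:\mu_\ell(X_t,\alpha)=\mu_0,\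 \lambda_\ell(X_t,\alpha)=\lambda_0\}\big).$$ *)

(* Defs.v *)
From HB Require Import structures.
From mathcomp Require Import all_boot all_order all_algebra.
From mathcomp Require Import all_classical all_reals all_analysis.

Set Implicit Arguments.
Unset Strict Implicit.
Unset Printing Implicit Defensive.

Import Order.TTheory GRing.Theory Num.Theory.
Import numFieldNormedType.Exports.

Local Open Scope classical_set_scope.
Local Open Scope ring_scope.

(* Z_p is the inverse limit of the rings Z/p^(n+1), n >= 0.  The nat cast *)
(* [(x n.+1 : nat)%:R] is the reduction Z/p^(n+2) -> Z/p^(n+1). *)
(* The type makes sense for all p : nat, but is only meant for p prime: 'Z_0 *)
(* and 'Z_1 denote Z/2 in MathComp. *)
Record padic_int (p : nat) := PadicInt {
  residue :> forall n, 'Z_(p ^ n.+1);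
  residueP : forall n, (nat_of_ord (residue n.+1))%:R = residue n }.

HB.instance Definition _ p := gen_eqMixin (padic_int p).
HB.instance Definition _ p := gen_choiceMixin (padic_int p).

Lemma padicP p (x y : padic_int p) : (forall n, x n = y n) -> x = y.
Proof.
case: x y => [x xP] [y yP] /= exy.
have {}exy : x = y by apply: functional_extensionality_dep.
by rewrite exy in xP *; congr PadicInt; exact: Prop_irrelevance.
Qed.

Section PadicRing.
Variable p : nat.
Implicit Types x y z : padic_int p.

Lemma Zp_trunc_dvd n : ((Zp_trunc (p ^ n.+1)).+2 %| (Zp_trunc (p ^ n.+2)).+2)%N.
Proof.
case: p => [|[|q]]; rewrite ?exp0n ?exp1n //.
by rewrite !Zp_cast ?(ltn_exp2l 0) ?dvdn_exp2l.
Qed.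

Let red n (a : 'Z_(p ^ n.+2)) : 'Z_(p ^ n.+1) := (nat_of_ord a)%:R.

Lemma redE n (k : nat) : red (inZp k : 'Z_(p ^ n.+2)) = k%:R.
Proof. by apply: val_inj; rewrite /red !Zp_nat /= modn_dvdm ?Zp_trunc_dvd. Qed.

Lemma redD n (a b : 'Z_(p ^ n.+2)) : red (a + b) = red a + red b.
Proof. by rewrite -natrD -redE. Qed.

Lemma redM n (a b : 'Z_(p ^ n.+2)) : red (a * b) = red a * red b.
Proof. by rewrite -natrM -redE. Qed.

Lemma red_nat n k : red (k%:R : 'Z_(p ^ n.+2)) = k%:R.
Proof. by rewrite Zp_nat redE. Qed.

Lemma redN n (a : 'Z_(p ^ n.+2)) : red (- a) = - red a.
Proof.
by apply/eqP; rewrite -addr_eq0 -redD addNr; apply/eqP; exact: (red_nat _ 0).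
Qed.

Definition padic_zero : padic_int p := PadicInt (fun n => red_nat n 0).
Definition padic_one : padic_int p := PadicInt (fun n => red_nat n 1).

Lemma padic_opp_subproof x n : red (- x n.+1) = - x n.
Proof. by rewrite redN /red residueP. Qed.
Definition padic_opp x := PadicInt (padic_opp_subproof x).

Lemma padic_add_subproof x y n : red (x n.+1 + y n.+1) = x n + y n.
Proof. by rewrite redD /red !residueP. Qed.
Definition padic_add x y := PadicInt (padic_add_subproof x y).

Lemma padic_mul_subproof x y n : red (x n.+1 * y n.+1) = x n * y n.
Proof. by rewrite redM /red !residueP. Qed.
Definition padic_mul x y := PadicInt (padic_mul_subproof x y).

Fact padic_addA : associative padic_add.
Proof. by move=> x y z; apply: padicP => n /=; rewrite addrA. Qed.
Fact padic_addC : commutative padic_add.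
Proof. by move=> x y; apply: padicP => n /=; rewrite addrC. Qed.
Fact padic_add0 : left_id padic_zero padic_add.
Proof. by move=> x; apply: padicP => n /=; rewrite add0r. Qed.
Fact padic_addN : left_inverse padic_zero padic_opp padic_add.
Proof. by move=> x; apply: padicP => n /=; rewrite addNr. Qed.

HB.instance Definition _ := GRing.isZmodule.Build (padic_int p)
  padic_addA padic_addC padic_add0 padic_addN.

Fact padic_mulA : associative padic_mul.
Proof. by move=> x y z; apply: padicP => n /=; rewrite mulrA. Qed.
Fact padic_mulC : commutative padic_mul.
Proof. by move=> x y; apply: padicP => n /=; rewrite mulrC. Qed.
Fact padic_mul1 : left_id padic_one padic_mul.
Proof. by move=> x; apply: padicP => n /=; rewrite mul1r. Qed.
Fact padic_mulD : left_distributive padic_mul padic_add.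
Proof. by move=> x y z; apply: padicP => n /=; rewrite mulrDl. Qed.
Fact padic_one_neq0 : padic_one != 0.
Proof. by apply/eqP => /(congr1 (fun x : padic_int p => x 0%N : nat)). Qed.

HB.instance Definition _ := GRing.Zmodule_isComNzRing.Build (padic_int p)
  padic_mulA padic_mulC padic_mul1 padic_mulD padic_one_neq0.

End PadicRing.

(* The p-adic topology: the cosets x + p^(n+1) Z_p form a basis of neighborhoods *)
(* of x. *)
Section PadicTopology.
Variable p : nat.
Implicit Types x y : padic_int p.

Definition padic_coset x n : set (padic_int p) := [set y | y n = x n].

Definition padic_nbhs x : set_system (padic_int p) :=
  filter_from setT (padic_coset x).

HB.instance Definition _ := hasNbhs.Build (padic_int p) padic_nbhs.

Lemma padic_cosetS x m n : (m <= n)%N -> padic_coset x n `<=` padic_coset x m.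
Proof.
move=> /subnK <-; elim: (n - m)%N => [//|k IH] y /= yx.
by apply: IH; rewrite /padic_coset /= -(residueP x) -(residueP y) -addSn yx.
Qed.

Fact padic_nbhs_filter x : ProperFilter (nbhs x).
Proof.
apply: filter_from_proper; last by move=> n _; exists x.
apply: filter_from_filter; first by exists 0%N.
move=> m n _ _; exists (maxn m n) => // y yx.
by split; apply: padic_cosetS yx; rewrite (leq_maxl, leq_maxr).
Qed.

Fact padic_nbhs_singleton x (A : set (padic_int p)) : nbhs x A -> A x.
Proof. by case=> n _; apply. Qed.

Fact padic_nbhs_nbhs x (A : set (padic_int p)) :
  nbhs x A -> nbhs x (nbhs^~ A).
Proof.
case=> n _ xA; exists n => // y yx; exists n => // z zy.
by apply: xA; rewrite /padic_coset/= zy.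
Qed.

HB.instance Definition _ := Nbhs_isNbhsTopological.Build (padic_int p)
  padic_nbhs_filter padic_nbhs_singleton padic_nbhs_nbhs.

HB.instance Definition _ := isPointed.Build (padic_int p) 0.

End PadicTopology.

(* The generalized binomial coefficient b(b-1)...(b-n+1) / n!, defined as the *)
(* solution c of n! c = b(b-1)...(b-n+1).  For p prime it exists (padic_binP) and *)
(* is unique (padic_bin_unique). *)
Definition padic_bin p (b : padic_int p) (n : nat) : padic_int p :=
  xget 0 [set c | n`!%:R * c = \prod_(i < n) (b - i%:R)].

Section PadicBinomial.
Variable p : nat.
Hypothesis p_prime : prime p.
Implicit Types b c x : padic_int p.

Let pn_gt1 n : (1 < p ^ n.+1)%N.
Proof. by rewrite -(exp1n n.+1) ltn_exp2r // prime_gt1. Qed.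

Lemma natZp_eq n i j :
  (i%:R == j%:R :> 'Z_(p ^ n.+1)) = (i == j %[mod p ^ n.+1])%N.
Proof. by rewrite -val_eqE /= !val_Zp_nat. Qed.

Lemma residue_mod x n m : (x (n + m)%N = x n %[mod p ^ n.+1])%N.
Proof.
elim: m => [|m IH]; first by rewrite addn0.
rewrite -{}IH addnS -(residueP x (n + m)) val_Zp_nat //.
by rewrite modn_dvdm // dvdn_exp2l // ltnS leq_addr.
Qed.

Lemma residue_natr x n m : (x (n + m)%N : nat)%:R = x n.
Proof. by rewrite -[RHS]natr_Zp; apply/eqP; rewrite natZp_eq residue_mod. Qed.

Lemma residue_nat n k : (k%:R : padic_int p) n = k%:R.
Proof. by elim: k => // k IH; rewrite [RHS]mulrS -IH mulrS. Qed.

Lemma padic_natr_inj k c c' : (0 < k)%N -> k%:R * c = k%:R * c' -> c = c'.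
Proof.
move=> k_gt0 /eqP; rewrite -subr_eq0 -mulrBr => /eqP kc0.
apply/eqP; rewrite -subr_eq0; move: (c - c') kc0 => d kd0.
apply/eqP/padicP => n; set v := logn p k.
have: (k * d (n + v)%N == 0 %[mod p ^ (n + v).+1])%N.
  rewrite -natZp_eq natrM natr_Zp -residue_nat.
  by apply/eqP; exact: (congr1 (fun x : padic_int p => x (n + v)%N) kd0).
rewrite mod0n -/(dvdn _ _) => kd.
have pd : (p ^ n.+1 %| d (n + v)%N)%N.
  have [r pr kE] := pfactor_coprime p_prime k_gt0.
  move: (nat_of_ord (d (n + v)%N)) kd => e; rewrite kE -/v -addSn expnD mulnAC.
  rewrite dvdn_pmul2r ?expn_gt0 ?prime_gt0 //.
  by rewrite Gauss_dvdr // coprimeXl.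
rewrite -(residue_natr d n v); apply/eqP.
by rewrite (natZp_eq _ _ 0) mod0n.
Qed.

Let ffactr (R : comNzRingType) m n :
  (m ^_ n)%:R = \prod_(i < n) (m%:R - i%:R) :> R.
Proof.
have [le_nm|lt_mn] := leqP n m.
  rewrite ffact_prod natr_prod; apply: eq_bigr => -[i /= lt_in] _.
  by rewrite natrB // ltnW // (leq_trans lt_in).
rewrite ffact_small // (bigD1 (Ordinal lt_mn)) //=.
by rewrite subrr mul0r.
Qed.

Let bin_mod m n i j k : (logn p n`! <= k)%N -> (i = j %[mod p ^ (m + k).+1])%N ->
  ('C(i, n) = 'C(j, n) %[mod p ^ m.+1])%N.
Proof.
move=> le_vk eq_ij.
have: (n`! * 'C(i, n) == n`! * 'C(j, n) %[mod p ^ (m + k).+1])%N.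
  rewrite -natZp_eq !(mulnC n`!) !bin_ffact !ffactr.
  have /eqP -> // : i%:R == j%:R :> 'Z_(p ^ (m + k).+1).
  by rewrite natZp_eq eq_ij.
wlog le_ji : i j {eq_ij} / ('C(j, n) <= 'C(i, n))%N => [hw|].
  have [|/ltnW] := leqP 'C(j, n) 'C(i, n); first exact: hw.
  by move=> le_ij; rewrite eq_sym => ?; apply/esym/hw.
rewrite eqn_mod_dvd ?leq_mul2l ?le_ji ?orbT // -mulnBr => dvd_n.
apply/eqP; rewrite eqn_mod_dvd //.
have [r pr nE] := pfactor_coprime p_prime (fact_gt0 n).
have: (p ^ (m.+1 + logn p n`!) %| n`! * ('C(i, n) - 'C(j, n)))%N.
  by apply: dvdn_trans dvd_n; rewrite dvdn_exp2l // -addSn leq_add2l.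
rewrite [X in (_ %| X * _)%N]nE expnD mulnAC.
rewrite dvdn_pmul2r ?expn_gt0 ?prime_gt0 //.
by rewrite Gauss_dvdr // coprimeXl.
Qed.

Lemma padic_binP b n : n`!%:R * padic_bin b n = \prod_(i < n) (b - i%:R).
Proof.
suff [c cP] : exists c, n`!%:R * c = \prod_(i < n) (b - i%:R).
  by rewrite /padic_bin; case: xgetP => [x _ //|/(_ c)].
pose v := logn p n`!.
have c_compat m : (nat_of_ord (('C(b (m.+1 + v)%N, n))%:R : 'Z_(p ^ m.+2)))%:R
    = ('C(b (m + v)%N, n))%:R :> 'Z_(p ^ m.+1).
  rewrite (red_nat p m); apply/eqP; rewrite natZp_eq; apply/eqP.
  apply: (@bin_mod _ _ _ _ v) => //.
  by rewrite -(residue_mod b (m + v) 1) addn1 addSn.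
exists (PadicInt c_compat); apply: padicP => m.
have resM : {morph (fun x : padic_int p => x m) : x y / x * y} by [].
have res1 : (1 : padic_int p) m = 1 by [].
have resB x y : (x - y) m = x m - y m by [].
rewrite resM residue_nat -natrM mulnC bin_ffact ffactr.
rewrite residue_natr (big_morph _ resM res1).
by apply: eq_bigr => i _; rewrite resB residue_nat.
Qed.

Lemma padic_bin_unique b n c :
  n`!%:R * c = \prod_(i < n) (b - i%:R) -> c = padic_bin b n.
Proof. by rewrite -padic_binP; apply: padic_natr_inj; rewrite fact_gt0. Qed.

End PadicBinomial.

Record fps (R : Type) := Fps { fps_coef : nat -> R }.

HB.instance Definition _ R := gen_eqMixin (fps R).
HB.instance Definition _ R := gen_choiceMixin (fps R).

Section FpsRing.
Variable R : comNzRingType.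
Implicit Types f g h : fps R.

Lemma fpsP f g : (forall n, fps_coef f n = fps_coef g n) -> f = g.
Proof. by case: f g => [f] [g] /= fg; congr Fps; apply/funext. Qed.

Definition fps_of_poly (q : {poly R}) : fps R := Fps (fun n => q`_n).

Definition fps_opp f := Fps (fun n => - fps_coef f n).
Definition fps_add f g := Fps (fun n => fps_coef f n + fps_coef g n).
Definition fps_mul f g :=
  Fps (fun n => \sum_(i < n.+1) fps_coef f i * fps_coef g (n - i)%N).

Fact fps_addA : associative fps_add.
Proof. by move=> f g h; apply: fpsP => n /=; rewrite addrA. Qed.
Fact fps_addC : commutative fps_add.
Proof. by move=> f g; apply: fpsP => n /=; rewrite addrC. Qed.
Fact fps_add0 : left_id (fps_of_poly 0) fps_add.
Proof. by move=> f; apply: fpsP => n /=; rewrite coef0 add0r. Qed.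
Fact fps_addN : left_inverse (fps_of_poly 0) fps_opp fps_add.
Proof. by move=> f; apply: fpsP => n /=; rewrite coef0 addNr. Qed.

HB.instance Definition _ := GRing.isZmodule.Build (fps R)
  fps_addA fps_addC fps_add0 fps_addN.

Let trunc n f := \poly_(i < n.+1) fps_coef f i.

Let coef_trunc n f i : (i <= n)%N -> (trunc n f)`_i = fps_coef f i.
Proof. by move=> le_in; rewrite coef_poly ltnS le_in. Qed.

Let fps_mulE n f g i : (i <= n)%N ->
  fps_coef (fps_mul f g) i = (trunc n f * trunc n g)`_i.
Proof.
move=> le_in; rewrite coefM; apply: eq_bigr => -[j /= lt_ji] _.
by rewrite !coef_trunc // (leq_trans _ le_in) ?leq_subr.
Qed.

Fact fps_mulC : commutative fps_mul.
Proof. by move=> f g; apply: fpsP => n; rewrite !(@fps_mulE n) // mulrC. Qed.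
Fact fps_mulA : associative fps_mul.
Proof.
move=> f g h; apply: fpsP => n.
transitivity ((trunc n f * (trunc n g * trunc n h))`_n).
  rewrite coefM; apply: eq_bigr => -[j /= lt_jn] _.
  by rewrite coef_trunc // -(@fps_mulE n) // leq_subr.
rewrite mulrA coefM; apply: eq_bigr => -[j /= lt_jn] _.
by rewrite (@coef_trunc n h) ?leq_subr // -(@fps_mulE n).
Qed.
Fact fps_mul1 : left_id (fps_of_poly 1) fps_mul.
Proof.
move=> f; apply: fpsP => n /=; rewrite big_ord_recl /= coef1 mul1r subn0.
by rewrite big1 ?addr0 // => i _; rewrite coef1 mul0r.
Qed.
Fact fps_mulD : left_distributive fps_mul fps_add.
Proof.
move=> f g h; apply: fpsP => n /=; rewrite -big_split /=.
by apply: eq_bigr => i _; rewrite mulrDl.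
Qed.
Fact fps_one_neq0 : fps_of_poly 1 != 0.
Proof.
by apply/eqP => /(congr1 (fun f => fps_coef f 0)) /eqP /=; rewrite coef0 coef1 oner_eq0.
Qed.

HB.instance Definition _ := GRing.Zmodule_isComNzRing.Build (fps R)
  fps_mulA fps_mulC fps_mul1 fps_mulD fps_one_neq0.

Definition fps_unit f := exists g, f * g = 1.

End FpsRing.

Section Bouquet.
Variables (l t : nat).
Implicit Types alpha : 'rV[padic_int l]_t.

(* (1 + T)^b *)
Definition binomial_series (b : padic_int l) : fps (padic_int l) :=
  Fps (padic_bin b).

Definition char_series alpha : fps (padic_int l) :=
  \sum_(j < t) (2 - binomial_series (alpha 0 j) - binomial_series (- alpha 0 j)).

Definition padic_dvd (c : padic_int l) := exists d, c = l%:R * d.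

Definition admissible : set 'rV[padic_int l]_t :=
  ~` [set alpha | forall j, padic_dvd (alpha 0 j)].

Definition distinguished (g : {poly padic_int l}) :=
  g \is monic /\ forall i, (i < (size g).-1)%N -> padic_dvd g`_i.

Definition weierstrass (f : fps (padic_int l)) (mu : nat)
    (g : {poly padic_int l}) :=
  distinguished g /\
  exists2 u, fps_unit u & f = l%:R ^+ mu * fps_of_poly g * u.

(* The pair (mu, g) of the Weierstrass preparation theorem; the default value *)
(* (0, 0) is only taken when f has no such factorization (f = 0). *)
Definition weierstrass_pair (f : fps (padic_int l)) : nat * {poly padic_int l} :=
  xget (0%N, 0) [set mg | weierstrass f mg.1 mg.2].

Definition mu_invariant alpha : nat := (weierstrass_pair (char_series alpha)).1.

(* (size g).-1 is deg g. *)
Definition lambda_invariant alpha : int :=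
  ((size (weierstrass_pair (char_series alpha)).2).-1)%:Z - 1.

End Bouquet.

(* The topology of 'rV is the product topology, so this is the Borel *)
(* sigma-algebra of Z_l^t. *)
Definition padic_borel (l t : nat) :=
  g_sigma_algebraType (@open 'rV[padic_int l]_t).
HB.instance Definition _ l t := Measurable.on (padic_borel l t).

(* The normalized Haar measure: a translation-invariant Borel measure of total *)
(* mass 1.  Regularity is automatic because Z_l^t is compact and metrizable. *)
Definition is_haar (R : realType) (l t : nat)
    (tau : probability (padic_borel l t) R) :=
  forall (a : 'rV[padic_int l]_t) (A : set (padic_borel l t)),
    measurable A -> tau [set x + a | x in (A : set 'rV[padic_int l]_t)] = tau A.

Definition prob_invariants (R : realType) (l t : nat)
    (tau : probability (padic_borel l t) R) (mu0 : nat) (lambda0 : int) : \bar R :=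
  (((1 - l%:R ^- t)^-1)%:E *
   tau [set alpha | [/\ @admissible l t alpha, mu_invariant alpha = mu0
                      & lambda_invariant alpha = lambda0]])%E.

(* Main.v *)
(* Modulo l the T^n-coefficient of n! f is minus the sum over the loops of an even
   polynomial in alpha_j of degree n (or n - 1). The coefficients of index < 2
   vanish, the first one that does not is the one of index 2, 4 or 6, and these
   are, successively, nonzero multiples of the power sums p2, p4, p6 of the
   residues. By Weierstrass preparation mu = 0 and lambda = n - 1 for the first
   index n at which the coefficient is a unit, so the event only depends on alpha
   mod l and its Haar measure is a point count over F_l:
   the conic p2 = 0 has l^2 points in F_l^3, and p2 = p4 = 0 has 8(l - 1) nonzero
   ones if l = 1 mod 3, none if l = 2 mod 3; p6 never vanishes on them. *)
Require Import Defs.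
From HB Require Import structures.
From mathcomp Require Import all_boot all_order all_algebra all_fingroup.
From mathcomp Require Import all_solvable all_field.
From mathcomp Require Import all_classical all_reals all_analysis.
From mathcomp Require Import ring zify.

Import Order.TTheory GRing.Theory Num.Theory.

Local Open Scope ring_scope.

(** * Formal power series: coefficients and units *)

Section PowerSeries.
Context {R : comNzRingType}.
Implicit Types (f g : fps R) (v : R) (n i k : nat).

Lemma fps_coefD f g n : fps_coef (f + g) n = fps_coef f n + fps_coef g n.
Proof. by []. Qed.

Lemma fps_coefB f g n : fps_coef (f - g) n = fps_coef f n - fps_coef g n.
Proof. by []. Qed.

Lemma fps_coef0 n : fps_coef (0 : fps R) n = 0.
Proof. by rewrite /= coef0. Qed.

Lemma fps_coef1 n : fps_coef (1 : fps R) n = (n == 0%N)%:R.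
Proof. by rewrite /= coef1. Qed.

Lemma fps_coefM f g n :
  fps_coef (f * g) n = \sum_(i < n.+1) fps_coef f i * fps_coef g (n - i)%N.
Proof. by []. Qed.

Lemma fps_coef_sum (I : Type) (r : seq I) (P : pred I) (F : I -> fps R) n :
  fps_coef (\sum_(i <- r | P i) F i) n = \sum_(i <- r | P i) fps_coef (F i) n.
Proof.
exact: (big_morph (fun f => fps_coef f n) (fun f g => fps_coefD f g n)
  (fps_coef0 n)).
Qed.

Lemma fps_coef_natl k f n : fps_coef (k%:R * f) n = k%:R * fps_coef f n.
Proof.
rewrite !mulr_natl; elim: k => [|k IH]; first by rewrite !mulr0n fps_coef0.
by rewrite !mulrS fps_coefD IH.
Qed.

Lemma fps_coef_nat k n : fps_coef (k%:R : fps R) n = (k * (n == 0))%N%:R.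
Proof. by rewrite -[k%:R]mulr1 fps_coef_natl fps_coef1 natrM. Qed.

Lemma fps_coefM0 f g : fps_coef (f * g) 0 = fps_coef f 0 * fps_coef g 0.
Proof. by rewrite fps_coefM big_ord1. Qed.

Definition fps_const v : fps R := fps_of_poly v%:P.

Lemma fps_coef_constM v f n : fps_coef (fps_const v * f) n = v * fps_coef f n.
Proof.
rewrite fps_coefM big_ord_recl big1 => [|i _]; rewrite /= coefC ?mul0r //.
by rewrite addr0 subn0.
Qed.

Definition fps_Xn n : fps R := fps_of_poly 'X^n.

Lemma fps_coef_XnM n f i :
  fps_coef (fps_Xn n * f) i = if (i < n)%N then 0 else fps_coef f (i - n)%N.
Proof.
rewrite fps_coefM; case: ltnP => [lt_in|le_ni].
  rewrite big1 // => -[j /= lt_j] _; rewrite coefXn ltn_eqF ?mul0r //.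
  exact: leq_trans lt_j lt_in.
have lt_n : (n < i.+1)%N by [].
rewrite (bigD1 (Ordinal lt_n)) //= coefXn eqxx mul1r big1 ?addr0 // => j.
by rewrite -val_eqE /= coefXn => /negPf ->; rewrite mul0r.
Qed.

(* Only finitely many terms of the geometric series contribute to each
   coefficient of the inverse of 1 - N, N having constant term 0. *)
Lemma fps_unitP f v : fps_coef f 0 * v = 1 -> fps_unit f.
Proof.
move=> f0v; pose N := 1 - fps_const v * f.
have N0 : fps_coef N 0 = 0.
  by rewrite fps_coefB fps_coef1 fps_coef_constM mulrC f0v subrr.
have NX k i : (i < k)%N -> fps_coef (N ^+ k) i = 0.
  elim: k i => // k IH i lt_ik; rewrite exprS fps_coefM big1 // => -[[|j] lt_j] _.
    by rewrite N0 mul0r.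
  by rewrite IH ?mulr0 //=; lia.
pose S := Fps (fun n => fps_coef (\sum_(k < n.+1) N ^+ k) n).
have SE i n : (i <= n)%N -> fps_coef S i = fps_coef (\sum_(k < n.+1) N ^+ k) i.
  elim: n => [|n IH]; first by rewrite leqn0 => /eqP ->.
  rewrite leq_eqVlt => /predU1P[->//|lt_in].
  by rewrite big_ord_recr fps_coefD NX // addr0; apply: IH.
exists (S * fps_const v); rewrite mulrA.
have -> : f * S * fps_const v = (1 - N) * S.
  by rewrite /N subKr mulrAC [f * _]mulrC.
apply: fpsP => n; transitivity (fps_coef ((1 - N) * \sum_(k < n.+1) N ^+ k) n).
  by rewrite !fps_coefM; apply: eq_bigr => i _; rewrite (SE _ n) ?leq_subr.
by rewrite -opprB mulNr -subrX1 opprB fps_coefB NX ?subr0.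
Qed.

End PowerSeries.

(** * Coefficientwise image of a power series under a ring morphism *)

Section MapPowerSeries.
Context {R S : comNzRingType} (phi : {rmorphism R -> S}).

Definition map_fps (f : fps R) : fps S := Fps (fun n => phi (fps_coef f n)).

Fact map_fps_zmod_morphism : zmod_morphism map_fps.
Proof. by move=> f g; apply: fpsP => n; rewrite /= rmorphB. Qed.

Fact map_fps_monoid_morphism : monoid_morphism map_fps.
Proof.
split=> [|f g]; apply: fpsP => n; first by rewrite /= !coef1 rmorph_nat.
by rewrite /= rmorph_sum; apply: eq_bigr => i _; rewrite rmorphM.
Qed.

HB.instance Definition _ :=
  GRing.isZmodMorphism.Build (fps R) (fps S) map_fps map_fps_zmod_morphism.
HB.instance Definition _ :=
  GRing.isMonoidMorphism.Build (fps R) (fps S) map_fps map_fps_monoid_morphism.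

End MapPowerSeries.

(** * Reduction of l-adic integers modulo powers of l and into ['F_l] *)

(** A named form of the coercion [residue], so that it can carry a ring morphism structure and be
    fed to [map_fps]. *)
Definition padic_res {p} n (x : padic_int p) : 'Z_(p ^ n.+1) := x n.

Fact padic_res_zmod_morphism p n : zmod_morphism (@padic_res p n).
Proof. by []. Qed.
Fact padic_res_monoid_morphism p n : monoid_morphism (@padic_res p n).
Proof. by []. Qed.
HB.instance Definition _ p n :=
  GRing.isZmodMorphism.Build _ _ (@padic_res p n)
    (@padic_res_zmod_morphism p n).
HB.instance Definition _ p n :=
  GRing.isMonoidMorphism.Build _ _ (@padic_res p n)
    (@padic_res_monoid_morphism p n).

(* The proof of primality is an argument so that [rho] can be declared to be
   a ring morphism: 'F_l is Z/l only for l prime. *)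
Definition rho {l} of prime l := fun x : padic_int l => (x 0%N : nat)%:R : 'F_l.

Section Padic.
Context {l : nat} (l_prime : prime l).
Implicit Types x y : padic_int l.
Local Notation rho := (rho l_prime).

Lemma natFp_eq i j : (i%:R == j%:R :> 'F_l) = (i == j %[mod l])%N.
Proof. by rewrite -val_eqE /= !val_Fp_nat. Qed.

(** ['Z_(l ^ 1)], where the residue of index 0 lives, and ['F_l] are distinct types for Z/l; they
    are compared through natural representatives. *)
Lemma natFp_res (k : nat) : ((k%:R : 'Z_(l ^ 1)) : nat)%:R = k%:R :> 'F_l.
Proof.
apply/eqP; rewrite natFp_eq val_Zp_nat ?expn1 ?modn_mod //.
exact: prime_gt1.
Qed.

Fact rho_zmod_morphism : zmod_morphism rho.
Proof.
have rhoD x y : rho (x + y) = rho x + rho y.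
  by rewrite /rho -natrD -[RHS]natFp_res natrD !natr_Zp.
by move=> x y; apply/(canRL (addrK _)); rewrite -rhoD subrK.
Qed.

Fact rho_monoid_morphism : monoid_morphism rho.
Proof.
split=> [|x y]; first exact: (natFp_res 1).
by rewrite /rho -natrM -[RHS]natFp_res natrM !natr_Zp.
Qed.

HB.instance Definition _ :=
  GRing.isZmodMorphism.Build _ _ rho rho_zmod_morphism.
HB.instance Definition _ :=
  GRing.isMonoidMorphism.Build _ _ rho rho_monoid_morphism.

Lemma rho_l : rho l%:R = 0.
Proof. by rewrite rmorph_nat; apply/eqP; rewrite (natFp_eq _ 0) modnn mod0n. Qed.

Lemma eqn_mod_expS i j n :
  (l * i == l * j %[mod l ^ n.+1] = (i == j %[mod l ^ n]))%N.
Proof. by rewrite expnS -!muln_modr eqn_pmul2l // prime_gt0. Qed.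

Lemma residue_modl x n : (x n = x 0%N %[mod l])%N.
Proof. exact: (residue_mod l_prime x 0 n). Qed.

Lemma residue_modS x n : (x n.+1 = x n %[mod l ^ n.+1])%N.
Proof. by rewrite -(residue_mod l_prime x n 1) addn1. Qed.

Lemma rho_eq0 x : rho x = 0 -> padic_dvd x.
Proof.
move=> /eqP; rewrite (natFp_eq _ 0) mod0n => x0.
have pn_gt1 n : (1 < l ^ n.+1)%N by rewrite -(exp1n n.+1) ltn_exp2r // prime_gt1.
have dvd_x n : (l %| x n)%N.
  by rewrite /dvdn residue_modl.
(* Division by l loses one digit, so the quotient modulo l^(n+1) is read off from the residue of
   index n.+1. *)
have d_compat n : (nat_of_ord ((x n.+2 %/ l)%N%:R : 'Z_(l ^ n.+2)))%:R
    = (x n.+1 %/ l)%N%:R :> 'Z_(l ^ n.+1).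
  rewrite (red_nat l n); apply/eqP; rewrite (natZp_eq l_prime).
  rewrite -eqn_mod_expS ![(l * _)%N]mulnC !divnK //; apply/eqP.
  exact: residue_modS.
exists (PadicInt d_compat); apply: padicP => n.
transitivity (padic_res n (l%:R * PadicInt d_compat)); last by [].
rewrite rmorphM rmorph_nat /padic_res /= -natrM mulnC divnK //.
by rewrite -(residue_natr l_prime x n 1) addn1.
Qed.

Lemma padic_dvdP x : padic_dvd x <-> rho x = 0.
Proof.
split; last exact: rho_eq0.
by case=> y ->; rewrite rmorphM /= rho_l mul0r.
Qed.

(** All residues of x are prime to l, hence invertible; uniqueness of inverses makes the inverses
    compatible. *)
Lemma rho_unit x : rho x != 0 -> exists y, x * y = 1.
Proof.
rewrite (natFp_eq _ 0) mod0n => x0.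
have pn_gt1 n : (1 < l ^ n.+1)%N by rewrite -(exp1n n.+1) ltn_exp2r // prime_gt1.
have xU n : x n \is a GRing.unit.
  rewrite -[x n]natr_Zp unitZpE // coprimeXl // prime_coprime //.
  by rewrite /dvdn residue_modl.
have y_compat n : (nat_of_ord (x n.+1)^-1)%:R = (x n)^-1 :> 'Z_(l ^ n.+1).
  apply: (mulrI (xU n)); rewrite mulrV ?xU //.
  by rewrite -{1}(residueP x) -redM mulrV ?xU // (red_nat l n 1).
by exists (PadicInt y_compat); apply: padicP => n; apply: mulrV; apply: xU.
Qed.

(** Multiplication by l gains one digit, which makes the iteration in [padic_fps_fixpoint]
    contract. *)
Lemma padic_res_mull x y n :
  x n = y n -> padic_res n.+1 (l%:R * x) = padic_res n.+1 (l%:R * y).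
Proof.
move=> xy; apply/eqP; rewrite !rmorphM !rmorph_nat.
change (l%:R * x n.+1 == l%:R * y n.+1).
rewrite -[x n.+1]natr_Zp -[y n.+1]natr_Zp -!natrM (natZp_eq l_prime).
by rewrite eqn_mod_expS !residue_modS xy.
Qed.

Lemma rho_surj (c : 'F_l) : rho (c : nat)%:R = c.
Proof. by rewrite rmorph_nat natr_Zp. Qed.

End Padic.

(** * Weierstrass preparation and its invariants *)

Section Weierstrass.
Context {l : nat} (l_prime : prime l).
Local Notation Zl := (padic_int l).
Local Notation rho := (rho l_prime).
Local Notation rhoF := (map_fps rho).
Local Notation resF n := (map_fps (padic_res n)).

Lemma resF_eqP n (f g : fps Zl) :
  resF n f = resF n g <-> forall i, fps_coef f i n = fps_coef g i n.
Proof.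
split=> [eq_fg i|eq_fg]; last by apply: fpsP => i; apply: eq_fg.
exact: (congr1 (fun h => fps_coef h i) eq_fg).
Qed.

Lemma resF_mull n (f g : fps Zl) :
  resF n f = resF n g -> resF n.+1 (l%:R * f) = resF n.+1 (l%:R * g).
Proof.
move=> /resF_eqP eq_fg; apply/resF_eqP => i; rewrite !fps_coef_natl.
exact: (padic_res_mull l_prime).
Qed.

(** [Phi] preserves congruences modulo each l^(n+1), so [G] improves them by one digit and its
    iterates from 0 converge l-adically. *)
Lemma padic_fps_fixpoint (c : fps Zl) (Phi : fps Zl -> fps Zl) :
    (forall n f g, resF n f = resF n g -> resF n (Phi f) = resF n (Phi g)) ->
  exists z, z = c - l%:R * Phi z.
Proof.
move=> PhiP; pose G f := c - l%:R * Phi f; pose z k := iter k G 0.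
(* Modulo l the map [G] is constant, which starts the induction. *)
have G0 f g : resF 0 (G f) = resF 0 (G g).
  rewrite !rmorphB; congr (_ - _); apply/resF_eqP => i.
  rewrite !fps_coef_natl; set x := fps_coef _ _; set y := fps_coef _ _.
  have res0 u : padic_res 0 (l%:R * u) = 0 :> 'Z_(l ^ 1).
    rewrite rmorphM rmorph_nat (_ : l%:R = 0) ?mul0r //.
    by apply/eqP; rewrite (natZp_eq l_prime 0 l 0) mod0n expn1 modnn.
  exact: (etrans (res0 x) (esym (res0 y))).
have GS n f g : resF n f = resF n g -> resF n.+1 (G f) = resF n.+1 (G g).
  move=> eq_fg; rewrite !rmorphB; congr (_ - _).
  exact/resF_mull/PhiP.
(* From index n.+1 on the iterates no longer change modulo l^(n+1), so the limit takes its residue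
   of index n from [z n.+1]. *)
have zS n k : resF n (z (n.+1 + k)%N) = resF n (z n.+1).
  elim: n => [|n IH]; first exact: G0.
  exact: GS.
have lim_compat i n : (nat_of_ord (fps_coef (z n.+2) i n.+1))%:R
    = fps_coef (z n.+1) i n.
  rewrite residueP; apply: (resF_eqP n _ _).1.
  by rewrite -(zS n 1) addn1.
pose Z := Fps (fun i => PadicInt (lim_compat i)).
have ZE n : resF n Z = resF n (z n.+1) by apply/resF_eqP.
exists Z; rewrite -/(G Z); apply: fpsP => i; apply: padicP => -[|n].
  by have /resF_eqP -> := ZE 0%N; apply: (resF_eqP _ _ _).1; apply: G0.
have /resF_eqP -> := ZE n.+1.
by apply: (resF_eqP _ _ _).1; apply: GS; rewrite ZE.
Qed.

Lemma fps_unit_rho (f : fps Zl) : rho (fps_coef f 0) != 0 -> fps_unit f.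
Proof. by move=> /rho_unit [v /fps_unitP]. Qed.

(* Manin's proof: multiply f by the inverse of its part of degree >= n, so that
   h = T^n + l A; the series Z with h Z = T^n + (degree < n) is then the fixed
   point of the l-adic contraction Z |-> 1 - l * tail (A Z). *)
Lemma weierstrass_exists (f : fps Zl) (n : nat) :
    (forall i, (i < n)%N -> rho (fps_coef f i) = 0) -> rho (fps_coef f n) != 0 ->
  exists2 g, weierstrass f 0 g & size g = n.+1.
Proof.
move=> f_lt f_n.
pose tail (g : fps Zl) := Fps (fun i => fps_coef g (n + i)%N).
have [V UV1] : fps_unit (tail f) by apply: fps_unit_rho; rewrite /= addn0.
have [P PE] : exists P, f = l%:R * P + fps_Xn n * tail f.
  have /choice [d dE] : forall i, exists y,
      fps_coef f i = l%:R * y + if (i < n)%N then 0 else fps_coef f i.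
    move=> i; case: ltnP => [/f_lt /rho_eq0 [y ->]|_].
      by exists y; rewrite addr0.
    by exists 0; rewrite mulr0 add0r.
  exists (Fps d); apply: fpsP => i; rewrite dE fps_coefD fps_coef_natl.
  rewrite fps_coef_XnM /=; congr (_ + _).
  by case: ltnP => // le_ni; rewrite subnKC.
pose h := f * V; pose A := P * V.
have hE : h = l%:R * A + fps_Xn n.
  by rewrite /h [in LHS]PE mulrDl -!mulrA UV1 mulr1.
have [Z ZE] : exists Z, Z = 1 - l%:R * tail (A * Z).
  apply: padic_fps_fixpoint => m F G eqFG; apply/resF_eqP => i /=.
  by apply: (resF_eqP _ (A * F) (A * G)).1; rewrite !rmorphM; congr (_ * _).
(* The equation for [Z] says that the tail of [h * Z] is 1: from degree n on, the multiples of l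
   cancel. Below n only a multiple of l remains, so [g] is distinguished. *)
have hZ i : fps_coef (h * Z) i
    = if (i < n)%N then l%:R * fps_coef (A * Z) i else (i == n)%:R.
  rewrite hE mulrDl fps_coefD -mulrA fps_coef_natl fps_coef_XnM.
  case: ltnP => [_|le_ni]; first by rewrite addr0.
  rewrite {2}ZE fps_coefB fps_coef_natl /= subnKC // addrCA subrr addr0 coef1.
  by rewrite subn_eq0 eqn_leq le_ni andbT.
have [W ZW1] : fps_unit Z.
  apply: fps_unit_rho; rewrite ZE fps_coefB fps_coef_natl fps_coef1 rmorphB.
  by rewrite rmorphM /= rho_l mul0r subr0 rmorph1 oner_eq0.
pose g := \poly_(i < n.+1) fps_coef (h * Z) i.
have size_g : size g = n.+1.
  by rewrite size_poly_eq // [n.+1.-1]/= hZ ltnn eqxx oner_eq0.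
have gE : fps_of_poly g = h * Z.
  apply: fpsP => i; rewrite [LHS]coef_poly.
  case: ltnP => // lt_ni; rewrite hZ ltnNge (ltnW lt_ni) /=.
  by rewrite gtn_eqF.
exists g => //; split.
  split=> [|i].
    by rewrite monicE lead_coefE size_g [n.+1.-1]/= coef_poly ltnSn hZ ltnn eqxx.
  rewrite size_g /= => lt_in; exists (fps_coef (A * Z) i).
  by rewrite coef_poly ltnS (ltnW lt_in) hZ lt_in.
(* Since [g = f V Z], where [V] inverts [tail f] and [W] inverts [Z], the unit factor is
   [W * tail f]. *)
exists (W * tail f).
  by exists (V * Z); rewrite [W * _]mulrC mulrACA UV1 mul1r mulrC.
rewrite expr0 mul1r gE /h.
transitivity (f * (tail f * V) * (Z * W)); last by ring.
by rewrite UV1 ZW1 !mulr1.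
Qed.

(** Modulo l, a factor l^mu with mu > 0 would kill f, and a distinguished g becomes T^(deg g); hence
    deg g is the order of vanishing of f modulo l. *)
Lemma weierstrass_unique (f : fps Zl) (n mu : nat) (g : {poly Zl}) :
    (forall i, (i < n)%N -> rho (fps_coef f i) = 0) -> rho (fps_coef f n) != 0 ->
  weierstrass f mu g -> mu = 0%N /\ size g = n.+1.
Proof.
move=> f_lt f_n [[g_monic g_dist] [u [v uv1] fE]].
have rhoFl : rhoF l%:R = 0 :> fps 'F_l.
  by apply: fpsP => i; rewrite /= fps_coef_nat natrM rmorphM /= rho_l mul0r coef0.
have mu0 : mu = 0%N.
  apply: contraNeq f_n; rewrite -lt0n => mu_gt0.
  have rhoF0 : rhoF f = 0.
    by rewrite fE !rmorphM rmorphXn /= rhoFl -(prednK mu_gt0) exprS !mul0r.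
  by rewrite (_ : rho _ = fps_coef (rhoF f) n) // rhoF0 fps_coef0.
split=> //; move: fE; rewrite {}mu0 expr0 mul1r => fE.
set d := (size g).-1 in g_dist.
have size_g : size g = d.+1.
  by rewrite prednK // size_poly_gt0 monic_neq0.
have gE : rhoF (fps_of_poly g) = fps_Xn d.
  apply: fpsP => i; rewrite /= coefXn.
  case: (ltngtP i d) => [lt_id|lt_di|->].
  - by rewrite (padic_dvdP l_prime _).1 //; apply: g_dist.
  - by rewrite nth_default ?rmorph0 // size_g.
  - by move: g_monic; rewrite monicE lead_coefE => /eqP ->; rewrite rmorph1.
have rf i : rho (fps_coef f i) = if (i < d)%N then 0 else rho (fps_coef u (i - d)).
  by rewrite -(fps_coef_XnM d (rhoF u)) -gE -rmorphM -fE.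
have u0 : rho (fps_coef u 0) != 0.
  apply/eqP => u0; have /eqP := congr1 (fun h => rho (fps_coef h 0)) uv1.
  by rewrite fps_coefM0 rmorphM /= u0 mul0r coef1 rmorph1 eq_sym oner_eq0.
rewrite size_g; congr _.+1; apply/eqP; rewrite eqn_leq; apply/andP; split.
  by rewrite leqNgt; apply: contraNN f_n => lt_nd; rewrite rf lt_nd.
rewrite leqNgt; apply: contraNN u0 => /f_lt.
by rewrite rf ltnn subnn => ->.
Qed.

(** Existence excludes the default value of [xget], and uniqueness makes the answer independent of
    the pair it chooses. *)
Lemma weierstrass_pairE (f : fps Zl) (n : nat) :
    (forall i, (i < n)%N -> rho (fps_coef f i) = 0) -> rho (fps_coef f n) != 0 ->
  (weierstrass_pair f).1 = 0%N /\ size (weierstrass_pair f).2 = n.+1.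
Proof.
move=> f_lt f_n; apply: (weierstrass_unique f) => //.
have [g gP _] := weierstrass_exists f n f_lt f_n.
by rewrite /weierstrass_pair; case: xgetP => [mg _ //|/(_ (0%N, g))].
Qed.

End Weierstrass.

(** * The characteristic series modulo l *)

(* For n > 0 this is n! times the T^n-coefficient of 2 - (1+T)^a - (1+T)^-a. *)
Definition loop_coef {R : comNzRingType} n (a : R) :=
  - \prod_(i < n) (a - i%:R) - \prod_(i < n) (- a - i%:R).

Lemma loop_coefE {R : comNzRingType} (a : R) :
  [/\ loop_coef 1 a = 0, loop_coef 2 a = - 2 * a ^+ 2,
      loop_coef 3 a = 6 * a ^+ 2,
      loop_coef 4 a = - 2 * a ^+ 4 - 22 * a ^+ 2
    & loop_coef 5 a = 20 * a ^+ 4 + 100 * a ^+ 2 /\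
      loop_coef 6 a = - 2 * a ^+ 6 - 170 * a ^+ 4 - 548 * a ^+ 2].
Proof. by rewrite /loop_coef !big_ord_recr !big_ord0 /=; do ?split; ring. Qed.

(** The system is triangular: each odd-index coefficient involves only power sums already met, and
    [c 2], [c 4], [c 6] each bring in a new one with the nonzero factor -2. *)
Lemma first_nonzero_coef {F : idomainType} {c : nat -> F} {p2 p4 p6 : F}
    (n := if p2 != 0 then 2 else if p4 != 0 then 4 else 6%N) :
    2%:R != 0 :> F -> c 0%N = 0 -> c 1%N = 0 -> c 2%N = - 2 * p2 ->
    c 3%N = 6 * p2 -> c 4%N = - 2 * p4 - 22 * p2 ->
    c 5%N = 20 * p4 + 100 * p2 -> c 6%N = - 2 * p6 - 170 * p4 - 548 * p2 ->
    (n = 6%N -> p6 != 0) ->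
  (forall k, (k < n)%N -> c k = 0) /\ c n != 0.
Proof.
rewrite -oppr_eq0 /n => two_neq0 c0 c1 c2 c3 c4 c5 c6.
case: eqVneq => [p2_0|p2_neq0] /=; last first.
  by move=> _; split; [case=> [|[|]] | rewrite c2 mulf_neq0].
rewrite {}p2_0 in c2 c3 c4 c5 c6.
case: eqVneq => [p4_0|p4_neq0] /=; last first.
  move=> _; split; last by rewrite c4 mulr0 subr0 mulf_neq0.
  by case=> [|[|[|[|]]]] // _; rewrite ?c2 ?c3 mulr0.
rewrite {}p4_0 in c4 c5 c6 => /(_ erefl) p6_neq0.
split; last by rewrite c6 !mulr0 !subr0 mulf_neq0.
case=> [|[|[|[|[|[|]]]]]] // _;
  by rewrite ?c2 ?c3 ?c4 ?c5 !mulr0 ?subr0 ?addr0.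
Qed.

Section CharSeriesMod.
Context {l : nat} (l_prime : prime l) {t : nat}.
Implicit Types alpha : 'rV[padic_int l]_t.
Local Notation rho := (rho l_prime).

Definition power_sum {F : nzRingType} (v : 'rV[F]_t) k := \sum_j v 0 j ^+ k.

(** Multiplied by n!, the binomial is a polynomial in b and can be reduced modulo l; [factF_neq0]
    cancels n! later, for n < l. *)
Lemma rho_padic_bin (b : padic_int l) n :
  n`!%:R * rho (padic_bin b n) = \prod_(i < n) (rho b - i%:R).
Proof.
rewrite -(rmorph_nat rho) -rmorphM padic_binP // rmorph_prod.
by apply: eq_bigr => i _; rewrite rmorphB rmorph_nat.
Qed.

Lemma rho_char_series alpha n :
  n`!%:R * rho (fps_coef (char_series alpha) n) =
  \sum_j (((2 * (n == 0)) * n`!)%N%:R - \prod_(i < n) (rho (alpha 0 j) - i%:R)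
           - \prod_(i < n) (- rho (alpha 0 j) - i%:R)).
Proof.
rewrite fps_coef_sum rmorph_sum mulr_sumr; apply: eq_bigr => j _.
rewrite !fps_coefB fps_coef_nat 2!rmorphB rmorph_nat !mulrBr !rho_padic_bin.
by rewrite -natrM mulnC (rmorphN rho).
Qed.

Lemma natF_neq0 n : (0 < n < l)%N -> n%:R != 0 :> 'F_l.
Proof.
case/andP=> n_gt0 n_lt; rewrite (natFp_eq l_prime n 0) mod0n.
by rewrite modn_small // -lt0n.
Qed.

Lemma factF_neq0 n : (n < l)%N -> n`!%:R != 0 :> 'F_l.
Proof.
elim: n => [|n IH] n_lt; first by rewrite fact0 oner_eq0.
by rewrite factS natrM mulf_neq0 ?IH ?(ltnW n_lt) // natF_neq0 ?n_lt.
Qed.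

Lemma admissible_rho alpha : admissible alpha <-> map_mx rho alpha != 0.
Proof.
split=> [adm|/eqP neq0 dvd_alpha].
  apply/eqP => /rowP eq0; apply: adm => j; apply/(padic_dvdP l_prime).
  by have := eq0 j; rewrite !mxE.
apply: neq0; apply/rowP => j; rewrite !mxE.
by apply/padic_dvdP; apply: dvd_alpha.
Qed.

(** The default 6 is the right index only if the sixth power sum is nonzero; for three loops
    [first_unit_coef6] guarantees this. *)
Definition first_unit_coef (v : 'rV['F_l]_t) :=
  if power_sum v 2 != 0 then 2 else if power_sum v 4 != 0 then 4 else 6%N.

Lemma char_series_invariants alpha (v := map_mx rho alpha)
    (n := first_unit_coef v) :
    (n < l)%N -> (n = 6%N -> power_sum v 6 != 0) ->
  mu_invariant alpha = 0%N /\ lambda_invariant alpha = n.-1%:Z.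
Proof.
move=> n_lt n6.
(* As n < l, the factorials k! with k <= n are nonzero in ['F_l], so [c k] vanishes exactly when the
   k-th coefficient does. *)
pose c k := k`!%:R * rho (fps_coef (char_series alpha) k).
have c0 : c 0%N = 0.
  by rewrite /c rho_char_series big1 // => j _; rewrite !big_ord0 mulr2n addrK subrr.
have cE k : c k.+1 = \sum_j loop_coef k.+1 (v 0 j).
  rewrite /c rho_char_series; apply: eq_bigr => j _.
  by rewrite muln0 mul0n sub0r !mxE.
have c1 : c 1%N = 0.
  by rewrite cE big1 // => j _; have [] := loop_coefE (v 0 j).
have c2 : c 2%N = - 2 * power_sum v 2.
  by rewrite cE mulr_sumr; apply: eq_bigr => j _; have [] := loop_coefE (v 0 j).
have c3 : c 3%N = 6 * power_sum v 2.
  by rewrite cE mulr_sumr; apply: eq_bigr => j _; have [] := loop_coefE (v 0 j).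
have c4 : c 4%N = - 2 * power_sum v 4 - 22 * power_sum v 2.
  rewrite cE !mulr_sumr -sumrB; apply: eq_bigr => j _.
  by have [] := loop_coefE (v 0 j).
have c5 : c 5%N = 20 * power_sum v 4 + 100 * power_sum v 2.
  rewrite cE !mulr_sumr -big_split; apply: eq_bigr => j _.
  by have [_ _ _ _ []] := loop_coefE (v 0 j).
have c6 : c 6%N = - 2 * power_sum v 6 - 170 * power_sum v 4 - 548 * power_sum v 2.
  rewrite cE !mulr_sumr -!sumrB; apply: eq_bigr => j _.
  by have [_ _ _ _ []] := loop_coefE (v 0 j).
have n_gt1 : (1 < n)%N by rewrite /n /first_unit_coef; do 2?case: ifP.
have two_neq0 : 2%:R != 0 :> 'F_l by rewrite natF_neq0 // (leq_ltn_trans n_gt1).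
have [c_lt c_n] := first_nonzero_coef two_neq0 c0 c1 c2 c3 c4 c5 c6 n6.
have [] := weierstrass_pairE l_prime (char_series alpha) n.
- move=> k lt_kn; apply/eqP; have /eqP := c_lt k lt_kn.
  by rewrite mulf_eq0 (negPf (factF_neq0 k _)) // (ltn_trans lt_kn).
- by apply: contraNneq c_n => rho0; rewrite /c rho0 mulr0.
(* Here deg g = n, and [n_gt1] lets the integer n - 1 be written as the natural predecessor. *)
rewrite /mu_invariant /lambda_invariant => -> ->; split=> //=.
by rewrite -subn1 -subzn // ltnW.
Qed.

End CharSeriesMod.

(** * Common zeros of power sums in three variables over a finite field of odd order *)

Section TernaryCount.
Variable F : finFieldType.

Definition row3 (a b c : F) : 'rV[F]_3 := \row_j nth 0 [:: a; b; c] j.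

Lemma row3E (v : 'rV[F]_3) : v = row3 (v 0 0) (v 0 1) (v 0 2%:R).
Proof.
apply/rowP => j; rewrite mxE.
by case: j => -[|[|[|]]] // lt_j; congr (v _ _); apply: val_inj.
Qed.

Lemma row3_inj a b c a' b' c' :
  row3 a b c = row3 a' b' c' -> [/\ a = a', b = b' & c = c'].
Proof.
move/rowP => eq3; have := eq3 0; have := eq3 1; have := eq3 2%:R.
by rewrite !mxE.
Qed.

Lemma power_sum_row3 a b c k :
  power_sum (row3 a b c) k = a ^+ k + b ^+ k + c ^+ k.
Proof. by rewrite /power_sum !big_ord_recr big_ord0 /= !mxE add0r. Qed.

Hypothesis card_odd : odd #|F|.

(** The order of the additive group annihilates 1; if 2 were zero, an odd order would give 1 = 0. *)
Lemma odd_finField_two_neq0 : 2%:R != 0 :> F.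
Proof.
apply/eqP => two0; have := expg_cardG (finset.in_setT (1%R : F) : _ \in [set: F]%G).
rewrite cardsT FinRing.zmodXgE -(odd_double_half #|F|) card_odd.
rewrite mulrnDr -mul2n mulrnA.
by rewrite two0 mul0rn addr0 => /eqP; rewrite oner_eq0.
Qed.

(** Pigeonhole: every element is plus or minus a chosen root of its square, so the set [Q] of
    squares has more than half the elements of F, as does -1 - Q; hence they meet. *)
Lemma sum_two_squares_N1 : exists u v : F, u ^+ 2 + v ^+ 2 = -1.
Proof.
pose Q := [set x ^+ 2 | x : F].
pose r (s : F) := odflt 0 [pick x : F | x ^+ 2 == s].
have le_FQ : (#|F| <= 2 * #|Q|)%N.
  have <- : #|finset.setX [set: bool] Q| = (2 * #|Q|)%N.
    by rewrite cardsX cardsT card_bool.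
  rewrite -cardsT; apply: leq_trans (leq_imset_card
    (fun bs : bool * F => (-1) ^+ bs.1 * r bs.2) _).
  apply/subset_leq_card/fintype.subsetP => x _; apply/imsetP.
  have : r (x ^+ 2) ^+ 2 == x ^+ 2.
    by rewrite /r; case: pickP => // /(_ x); rewrite eqxx.
  rewrite eqf_sqr => /orP[/eqP rx|/eqP rx].
    exists (false, x ^+ 2) => /=; last by rewrite mul1r rx.
    by rewrite !inE; apply/imsetP; exists x.
  exists (true, x ^+ 2) => /=; last by rewrite mulN1r rx opprK.
  by rewrite !inE; apply/imsetP; exists x.
pose Q' := [set -1 - s | s in Q].
have card_Q' : #|Q'| = #|Q| by apply: card_imset => s s' /addrI /oppr_inj.
have /set0Pn [s] : Q :&: Q' != finset.set0.
  apply/eqP => disj; have := cardsUI Q Q'.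
  rewrite disj cards0 addn0 card_Q' addnn => card_U.
  have : (#|Q|.*2 <= #|F|)%N by rewrite -card_U max_card.
  rewrite -mul2n => le_QF.
  by have := card_odd; rewrite (@anti_leq #|F| (2 * #|Q|)%N) ?oddM // le_FQ.
rewrite inE => /andP[/imsetP[u _ ->] /imsetP[s' /imsetP[v _ ->] uv]].
by exists u, v; rewrite uv subrK.
Qed.

(* With u^2 + v^2 = -1 and X = ua + vb, Y = ub - va, the quadric
   a^2 + b^2 + c^2 = 0 becomes (c - X)(c + X) = Y^2. *)
Lemma card_conic : #|[set v : 'rV[F]_3 | power_sum v 2 == 0]| = (#|F| ^ 2)%N.
Proof.
have two := odd_finField_two_neq0.
have [u [v uv]] := sum_two_squares_N1.
(* This parametrizes P Q = Y^2 by pairs: P = 0 forces Y = 0 and leaves Q free, while for P nonzero Q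
   is determined by P and Y. *)
pose cone (x : F * F) : F * F * F :=
  if x.1 == 0 then (0, x.2, 0) else (x.1, x.2 ^+ 2 / x.1, x.2).
(* The inverse of the change of variables P = c - X, Q = c + X, Y; solving for a and b uses u^2 +
   v^2 = -1. *)
pose chg (PQY : F * F * F) : 'rV[F]_3 :=
  let: (P, Q, Y) := PQY in let X := (Q - P) / 2 in
  row3 (v * Y - u * X) (- (u * Y) - v * X) ((P + Q) / 2).
pose f x := chg (cone x).
have chgK P Q Y : let w := chg (P, Q, Y) in
    [/\ w 0 2%:R - (u * w 0 0 + v * w 0 1) = P,
        w 0 2%:R + (u * w 0 0 + v * w 0 1) = Q & u * w 0 1 - v * w 0 0 = Y].
  have XE (X : F) : u * (v * Y - u * X) + v * (- (u * Y) - v * X) = X.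
    by transitivity (- (u ^+ 2 + v ^+ 2) * X); [ring | rewrite uv; ring].
  rewrite /= !mxE /= XE; split; [by field|by field|].
  by transitivity (- (u ^+ 2 + v ^+ 2) * Y); [ring | rewrite uv; ring].
have chg_inj : injective chg.
  move=> [[P Q] Y] [[P' Q'] Y'] eqw.
  have [p q y] := chgK P Q Y; have [p' q' y'] := chgK P' Q' Y'.
  by congr (_, _, _); [rewrite -p -p' eqw | rewrite -q -q' eqw | rewrite -y -y' eqw].
have cone_inj : injective cone.
  move=> [x y] [x' y']; rewrite /cone /=.
  case: eqVneq => [->|x0]; case: eqVneq => [->|x0'] [] //.
  - by move=> ->.
  - by move=> x'0; rewrite -x'0 eqxx in x0'.
  - by move=> x'0; rewrite x'0 eqxx in x0.
  - by move=> -> _ ->.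
rewrite -[RHS]/(#|F| * #|F|)%N -card_prod -cardsT.
rewrite -(card_imset _ (inj_comp chg_inj cone_inj)); congr #|pred_of_set _|.
apply/finset.setP => w; rewrite inE; apply/idP/imsetP => [|[x _ ->]].
  rewrite [w]row3E; move: (w 0 0) (w 0 1) (w 0 2%:R) => a b c.
  rewrite power_sum_row3 => /eqP abc.
  pose X := u * a + v * b; pose Y := u * b - v * a.
  have XY : (c - X) * (c + X) = Y ^+ 2.
    have XY2 : X ^+ 2 + Y ^+ 2 = - (a ^+ 2 + b ^+ 2).
      transitivity ((u ^+ 2 + v ^+ 2) * (a ^+ 2 + b ^+ 2)); last by rewrite uv; ring.
      by rewrite /X /Y; ring.
    transitivity (a ^+ 2 + b ^+ 2 + c ^+ 2 - (a ^+ 2 + b ^+ 2)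
      - (X ^+ 2 + Y ^+ 2) + Y ^+ 2); first by ring.
    by rewrite abc XY2; ring.
  have chgE : chg (c - X, c + X, Y) = row3 a b c.
    have aE : v * Y - u * X = a.
      by transitivity (- (u ^+ 2 + v ^+ 2) * a);
        [rewrite /X /Y; ring | rewrite uv; ring].
    have bE : - (u * Y) - v * X = b.
      by transitivity (- (u ^+ 2 + v ^+ 2) * b);
        [rewrite /X /Y; ring | rewrite uv; ring].
    rewrite /chg (_ : (c + X - (c - X)) / 2 = X); last by field.
    by rewrite aE bE (_ : (c - X + (c + X)) / 2 = c) //; field.
  have [cX|cX] := eqVneq (c - X) 0.
    exists (0, c + X) => //=; rewrite /cone /= eqxx -chgE.
    move: XY; rewrite cX mul0r => /esym /eqP.
    by rewrite expf_eq0 => /andP[_ /eqP ->].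
  exists (c - X, Y) => //=; rewrite /cone /= (negPf cX) -XY mulrC mulKf //.
have conic z : z.1.1 * z.1.2 = z.2 ^+ 2 -> power_sum (chg z) 2 == 0.
  case: z => [[P Q] Y] /= PQ; rewrite /chg power_sum_row3; set X := (Q - P) / 2.
  apply/eqP.
  transitivity ((u ^+ 2 + v ^+ 2) * (X ^+ 2 + Y ^+ 2) + ((P + Q) / 2) ^+ 2).
    by ring.
  by rewrite uv -PQ /X; field.
apply: conic; rewrite /cone; case: x => x y /=; case: eqVneq => [_|x0] /=.
  by rewrite mul0r expr0n.
by rewrite mulrC divfK.
Qed.

(** Substituting c^2 = -(a^2 + b^2) into the quartic sum gives twice this expression. *)
Lemma common_zero (a b c : F) :
    a ^+ 2 + b ^+ 2 + c ^+ 2 = 0 -> a ^+ 4 + b ^+ 4 + c ^+ 4 = 0 ->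
  a ^+ 4 + a ^+ 2 * b ^+ 2 + b ^+ 4 = 0.
Proof.
move=> abc2 abc4; apply/(mulfI odd_finField_two_neq0); rewrite mulr0.
have cE : c ^+ 2 = - (a ^+ 2 + b ^+ 2).
  by apply/eqP; rewrite -addr_eq0 addrC abc2.
by rewrite -[RHS]abc4 (exprM c 2 2) cE; ring.
Qed.

(** Through the relation of [common_zero], applied to (a, b) and (b, c), one vanishing coordinate
    forces the others to vanish. *)
Lemma common_zero0 (a b c : F) :
    a ^+ 2 + b ^+ 2 + c ^+ 2 = 0 -> a ^+ 4 + b ^+ 4 + c ^+ 4 = 0 ->
  a * b * c = 0 -> row3 a b c = 0.
Proof.
move=> abc2 abc4 /eqP abc.
have ab := common_zero _ _ _ abc2 abc4.
have bc : b ^+ 4 + b ^+ 2 * c ^+ 2 + c ^+ 4 = 0.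
  by apply: (common_zero b c a); rewrite addrC addrA.
have sq0 (x y : F) : x = 0 -> x ^+ 4 + x ^+ 2 * y ^+ 2 + y ^+ 4 = 0 -> y = 0.
  by move=> ->; rewrite !expr0n mul0r !add0r => /eqP; rewrite expf_eq0 => /eqP.
have sq0' (x y : F) : y = 0 -> x ^+ 4 + x ^+ 2 * y ^+ 2 + y ^+ 4 = 0 -> x = 0.
  by move=> ->; rewrite !expr0n mulr0 !addr0 => /eqP; rewrite expf_eq0 => /eqP.
suff [-> -> ->] : [/\ a = 0, b = 0 & c = 0].
  by apply/rowP => j; rewrite !mxE; case: j => -[|[|[|]]].
move: abc; rewrite !mulf_eq0 => /orP[/orP[]|] /eqP z0.
- by have b0 := sq0 _ _ z0 ab; split=> //; apply: sq0 bc.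
- by split=> //; [apply: sq0' ab | apply: sq0 bc].
- by have b0 := sq0' _ _ z0 bc; split=> //; apply: sq0' ab.
Qed.

(** On the conic the sixth power sum equals 3 (abc)^2, and [common_zero0] shows that abc is
    nonzero. *)
Lemma common_zero_power_sum6 (v : 'rV[F]_3) : 3%:R != 0 :> F ->
  v != 0 -> power_sum v 2 = 0 -> power_sum v 4 = 0 -> power_sum v 6 != 0.
Proof.
move=> three_neq0; rewrite [v]row3E; move: (v 0 0) (v 0 1) (v 0 2%:R) => a b c.
rewrite !power_sum_row3 => v_neq0 abc2 abc4.
have -> : a ^+ 6 + b ^+ 6 + c ^+ 6 = 3 * (a * b * c) ^+ 2.
  have cE : c ^+ 2 = - (a ^+ 2 + b ^+ 2).
    by apply/eqP; rewrite -addr_eq0 addrC abc2.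
  by rewrite !exprMn (exprM c 2 3) cE; ring.
rewrite mulf_neq0 // expf_neq0 //; apply: contraNneq v_neq0 => abc.
by rewrite common_zero0.
Qed.

(** Otherwise x = (a/b)^2 satisfies x^2 + x + 1 = 0, so x^3 = 1. With q = 2 mod 3, x = x^q = x^2
    gives x = 1, and then 3 = 0. *)
Lemma common_zero_trivial (v : 'rV[F]_3) :
    (#|F| %% 3 = 2)%N -> 3%:R != 0 :> F ->
  power_sum v 2 = 0 -> power_sum v 4 = 0 -> v = 0.
Proof.
move=> q_mod3 three_neq0.
rewrite [v]row3E; move: (v 0 0) (v 0 1) (v 0 2%:R) => a b c.
rewrite !power_sum_row3 => abc2 abc4; apply: common_zero0 => //.
have [-> //|b_neq0] := eqVneq b 0; first by rewrite mulr0 mul0r.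
pose x := a ^+ 2 / b ^+ 2.
have b2 : b ^+ 2 != 0 by rewrite expf_neq0.
have x3 : x ^+ 2 + x + 1 = 0.
  apply: (mulIf (expf_neq0 2 b2)); rewrite mul0r -[RHS](common_zero _ _ _ abc2 abc4).
  by rewrite /x; field.
have x_cube : x ^+ 3 = 1.
  apply/eqP; rewrite -subr_eq0; apply/eqP.
  by transitivity ((x - 1) * (x ^+ 2 + x + 1)); [ring | rewrite x3 mulr0].
have x_neq0 : x != 0.
  by apply: contra_eq_neq x_cube => ->; rewrite expr0n eq_sym oner_eq0.
have x1 : x = 1.
  apply: (mulfI x_neq0); rewrite mulr1 -[RHS](expf_card x) (divn_eq #|F| 3) q_mod3.
  by rewrite exprD mulnC exprM x_cube expr1n mul1r.
by move/eqP: x3; rewrite x1 (_ : _ + _ = 3%:R) ?(negPf three_neq0) //; ring.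
Qed.

(** 3 divides the order of the unit group, so Cauchy's theorem provides an element of order 3. *)
Lemma exists_cube_root1 : (#|F| %% 3 = 1)%N -> 3%:R != 0 :> F ->
  exists w : F, w ^+ 2 + w + 1 = 0.
Proof.
move=> q_mod3 three_neq0.
have dvd3 : (3 %| #|[set: {unit F}]|)%N.
  rewrite card_finField_unit -subn1 -eqn_mod_dvd ?q_mod3 //.
  exact: ltnW (finNzRing_gt1 F).
have [u _ u_ord] := Cauchy (isT : prime 3) dvd3.
exists (FinRing.uval u).
have u3 : FinRing.uval u ^+ 3 = 1.
  by rewrite -FinRing.val_unitX -u_ord expg_order.
have u1 : FinRing.uval u - 1 != 0.
  rewrite subr_eq0; apply/eqP => u1; have : u = 1%g by apply: val_inj.
  by move=> u1'; rewrite u1' order1 in u_ord.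
apply: (mulfI u1); rewrite mulr0.
by transitivity (FinRing.uval u ^+ 3 - 1); [ring | rewrite u3 subrr].
Qed.

(* If w is a primitive cube root of unity, then (w^2)^2 = w, so the squares of
   the coordinates of a common zero are in the ratio 1 : w^{+-1} : w^{-+1}, and
   the coordinates themselves are (a, +-w' a, +-w'^2 a) with w' = w^{+-1}. *)
Lemma card_common_zeros : (#|F| %% 3 = 1)%N -> 3%:R != 0 :> F ->
  #|[set v : 'rV[F]_3 | [&& v != 0, power_sum v 2 == 0 & power_sum v 4 == 0]]|
    = (8 * #|F|.-1)%N.
Proof.
move=> q_mod3 three_neq0; have [w w_root] := exists_cube_root1 q_mod3 three_neq0.
have two := odd_finField_two_neq0.
have w3 : w ^+ 3 = 1.
  apply/eqP; rewrite -subr_eq0; apply/eqP.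
  by transitivity ((w - 1) * (w ^+ 2 + w + 1)); [ring | rewrite w_root mulr0].
have w4 : w ^+ 4 = w by rewrite exprS w3 mulr1.
have w_neq0 : w != 0.
  by apply: contra_eq_neq w3 => ->; rewrite expr0n eq_sym oner_eq0.
have w2w : w ^+ 2 != w.
  apply: contraNneq three_neq0 => w2w; apply/eqP.
  have w1 : w = 1 by apply: (mulfI w_neq0); rewrite mulr1 -expr2.
  by rewrite -w_root w1; ring.
pose om (s : bool) := if s then w else w ^+ 2.
have om_root s : om s ^+ 2 + om s + 1 = 0.
  by case: s => //=; rewrite /om -exprM w4 -[RHS]w_root; ring.
have om_neq0 s : om s != 0 by case: s; rewrite /om ?expf_neq0.
pose sg (e : bool) : F := (-1) ^+ e.
have sg2 e : sg e ^+ 2 = 1 by rewrite /sg sqrr_sign.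
have sg_inj : injective sg.
  have N1 : (-1 : F) != 1.
    by rewrite eq_sym -subr_eq0 opprK.
  by case=> [] [] //= /eqP; rewrite ?[_ == -1]eq_sym (negPf N1).
(* The factor 8: for each nonzero a, a choice between two primitive cube roots and two independent
   signs. *)
pose f (x : F * (bool * (bool * bool))) :=
  let: (a, (s, (e, e'))) := x in
  row3 a (sg e * om s * a) (sg e' * om s ^+ 2 * a).
pose D := finset.setX [set~ (0 : F)] [set: bool * (bool * bool)].
have card_D : #|D| = (8 * #|F|.-1)%N.
  by rewrite cardsX cardsC1 cardsT !card_prod !card_bool mulnC.
rewrite -card_D -[RHS](card_in_imset (f := f)); last first.
  move=> [a [s [e1 e2]]] [a' [s' [e1' e2']]]; rewrite !inE !andbT /= => a0 _.
  case/row3_inj => <- /(mulIf a0) eq1 /(mulIf a0) eq2.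
  (* Squaring removes the signs, and the square of [om s] still determines s because w^2 and w
     differ. *)
  have es : s = s'.
    have : om s ^+ 2 = om s' ^+ 2.
      by have := congr1 (fun x => x ^+ 2) eq1; rewrite !exprMn !sg2 !mul1r.
    case: (s) (s') => [] [] //; rewrite /om -exprM w4 => /eqP.
      by rewrite (negPf w2w).
    by rewrite eq_sym (negPf w2w).
  rewrite -{}es in eq1 eq2 *.
  by rewrite (sg_inj _ _ (mulIf (om_neq0 s) eq1))
    (sg_inj _ _ (mulIf (expf_neq0 2 (om_neq0 s)) eq2)).
congr #|pred_of_set _|; apply/finset.setP => v; rewrite inE.
apply/idP/imsetP => [|[[a [s [e e']]]]]; last first.
  rewrite !inE andbT /= => a0 ->; rewrite !power_sum_row3.
  have sq u x : (sg u * x * a) ^+ 2 = x ^+ 2 * a ^+ 2.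
    by rewrite exprMn exprMn sg2 mul1r.
  have quart u x : (sg u * x * a) ^+ 4 = x ^+ 4 * a ^+ 4.
    by rewrite (exprM _ 2 2) sq; ring.
  rewrite !sq !quart; apply/and3P; split.
  - apply: contraNneq a0 => /rowP /(_ 0); rewrite !mxE /= => ->.
    by rewrite eqxx.
  - apply/eqP; transitivity
      ((om s ^+ 2 + om s + 1) * (om s ^+ 2 - om s + 1) * a ^+ 2); first by ring.
    by rewrite om_root !mul0r.
  - apply/eqP; transitivity ((om s ^+ 2 + om s + 1) * (om s ^+ 2 - om s + 1)
      * (om s ^+ 4 - om s ^+ 2 + 1) * a ^+ 4); first by ring.
    by rewrite om_root !mul0r.
rewrite [v]row3E; move: (v 0 0) (v 0 1) (v 0 2%:R) => a b c.
rewrite !power_sum_row3 => /and3P[v_neq0 /eqP abc2 /eqP abc4].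
have a_neq0 : a != 0.
  apply: contraNneq v_neq0 => a0; apply/eqP; apply: common_zero0 => //.
  by rewrite a0 !mul0r.
(* With w^2 + w^4 = -1 and w^6 = 1, the relation of [common_zero] factors over the two candidates
   for b^2. *)
have bP : (b ^+ 2 - (om true * a) ^+ 2) * (b ^+ 2 - (om false * a) ^+ 2) = 0.
  rewrite -[RHS](common_zero _ _ _ abc2 abc4) /om.
  transitivity (b ^+ 4 - (w ^+ 2 + w ^+ 4) * a ^+ 2 * b ^+ 2
    + w ^+ 3 * w ^+ 3 * a ^+ 4); first by ring.
  rewrite w4 w3 (_ : w ^+ 2 + w = -1); first by ring.
  by apply/eqP; rewrite -addr_eq0 w_root.
have sgP x y : x ^+ 2 = y ^+ 2 -> exists e, x = sg e * y.
  move/eqP; rewrite eqf_sqr => /orP[] /eqP ->.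
    by exists false; rewrite mul1r.
  by exists true; rewrite mulN1r.
have [s bs] : exists s, b ^+ 2 = (om s * a) ^+ 2.
  move/eqP: bP; rewrite mulf_eq0 !subr_eq0 => /orP[] /eqP ->.
    by exists true.
  by exists false.
have cs : c ^+ 2 = (om s ^+ 2 * a) ^+ 2.
  have -> : c ^+ 2 = - (a ^+ 2 + b ^+ 2).
    by apply/eqP; rewrite -addr_eq0 addrC abc2.
  rewrite bs; apply/eqP; rewrite eq_sym -subr_eq0 opprK; apply/eqP.
  transitivity ((om s ^+ 2 + om s + 1) * (om s ^+ 2 - om s + 1) * a ^+ 2);
    first by ring.
  by rewrite om_root !mul0r.
have [e be] := sgP _ _ bs; have [e' ce] := sgP _ _ cs.
exists (a, (s, (e, e'))); first by rewrite !inE a_neq0.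
by rewrite /f be ce !mulrA.
Qed.

End TernaryCount.

(** * Haar measure of events determined by residues modulo l *)

Section HaarMod.
Local Open Scope classical_set_scope.
Context {R : realType} {l : nat} (l_prime : prime l) {t : nat}.
Variable tau : probability (padic_borel l t) R.
Hypothesis tau_haar : is_haar tau.
Local Notation rho := (rho l_prime).

Definition residue_class (c : 'rV['F_l]_t) : set (padic_borel l t) :=
  [set alpha : 'rV[padic_int l]_t | map_mx rho alpha = c].

(** The class is open, as it only depends on the residues of index 0. *)
Lemma measurable_residue_class c : measurable (residue_class c).
Proof.
apply: sub_sigma_algebra; rewrite openE => alpha /= alphac.
exists (fun i j => padic_coset (alpha i j) 0).
  by move=> i j; exists 0%N.
move=> beta beta_alpha; rewrite /residue_class /= -alphac.
apply/matrixP => i j; rewrite !mxE /rho.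
by rewrite (beta_alpha i j).
Qed.

(** Translation by an integral lift of c carries the class of 0 onto that of c. *)
Lemma haar_residue_class c : tau (residue_class c) = tau (residue_class 0).
Proof.
pose a : 'rV[padic_int l]_t := \row_j (c 0 j : nat)%:R.
have rho_a : map_mx rho a = c by apply/rowP => j; rewrite !mxE rho_surj.
rewrite -(tau_haar a (residue_class 0)); last exact: measurable_residue_class.
congr (tau _); apply/seteqP; split=> [alpha alphac|_ [alpha alpha0 <-]].
  exists (alpha - a); last exact: subrK.
  by rewrite /residue_class /= map_mxB alphac rho_a subrr.
by rewrite /residue_class /= map_mxD alpha0 add0r rho_a.
Qed.

(** The set is a disjoint union of #|S| classes of equal measure; the case of the whole space fixes
    that measure at l^-t. *)
Lemma haar_preimage_residue (S : {set 'rV['F_l]_t}) :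
  tau [set alpha : 'rV[padic_int l]_t | map_mx rho alpha \in S]
  = (#|S|%:R / l%:R ^+ t)%:E.
Proof.
have fin0 : tau (residue_class 0) \is a fin_num.
  exact: fin_num_measure (measurable_residue_class 0).
have tauE (A : {set 'rV['F_l]_t}) :
    tau [set alpha : 'rV[padic_int l]_t | map_mx rho alpha \in A]
    = (#|A|%:R * fine (tau (residue_class 0)))%:E.
  have -> : [set alpha : 'rV[padic_int l]_t | map_mx rho alpha \in A]
      = \bigcup_(c in [set` enum A]) residue_class c.
    apply/seteqP; split=> [alpha alphaA|alpha [c /= cA alphac]] /=.
      by exists (map_mx rho alpha); rewrite //= mem_enum.
    by rewrite alphac -mem_enum.
  rewrite measure_fin_bigcup; first last.
  - by move=> c _; apply: measurable_residue_class.
  - by move=> c c' _ _ [alpha [<- <-]].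
  - exact: finite_seq.
  rewrite -fsbig_seq ?enum_uniq // big_enum.
  rewrite (eq_bigr (fun=> (fine (tau (residue_class 0)))%:E)) => [|c _]; last first.
    by rewrite fineK //; apply: haar_residue_class.
  by rewrite sumEFin sumr_const mulr_natl.
have lt_neq0 : l%:R ^+ t != 0 :> R.
  by rewrite expf_neq0 // pnatr_eq0 -lt0n prime_gt0.
have := tauE finset.setT.
rewrite (_ : [set _ | _] = setT) ?probability_setT; last first.
  by apply/seteqP; split=> // alpha _ /=; rewrite finset.in_setT.
rewrite cardsT card_mx card_Fp // mul1n natrX => -[tau1].
by rewrite tauE; congr (_ * _)%:E; apply: (mulfI lt_neq0); rewrite -tau1 mulfV.
Qed.

End HaarMod.

(** * Invariants and residue counts for three loops *)

Section Bouquet3.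
Context {l : nat} (l_prime : prime l) (l_ge5 : (5 <= l)%N).
Local Notation rho := (rho l_prime).

Lemma odd_card_Fp : odd #|'F_l|.
Proof.
rewrite card_Fp //; case: (even_prime l_prime) => // l2.
by have := l_ge5; rewrite l2.
Qed.

Lemma three_Fp_neq0 : 3%:R != 0 :> 'F_l.
Proof. by apply: natF_neq0; rewrite //= (leq_trans _ l_ge5). Qed.

Lemma prime_ge5_mod3 : (l %% 3 = 1 \/ l %% 3 = 2)%N.
Proof.
have : (l %% 3 != 0)%N.
  rewrite -/(dvdn 3 l) dvdn_prime2 //; apply: contraTneq l_ge5 => <-.
  by [].
by case: (l %% 3)%N (ltn_pmod l (isT : (0 < 3)%N)) => [|[|[|]]] //; [left|right].
Qed.

Lemma first_unit_coef6 (v : 'rV['F_l]_3) :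
  v != 0 -> first_unit_coef v = 6%N -> (l %% 3 = 1)%N /\ power_sum v 6 != 0.
Proof.
move=> v_neq0; rewrite /first_unit_coef.
case: eqVneq => //= p2; case: eqVneq => //= p4 _; split.
  have [//|l2] := prime_ge5_mod3.
  case/eqP: v_neq0; apply: common_zero_trivial => //.
  - exact: odd_card_Fp.
  - by rewrite card_Fp.
  - exact: three_Fp_neq0.
apply: common_zero_power_sum6 => //; first exact: odd_card_Fp.
exact: three_Fp_neq0.
Qed.

Lemma bouquet3_invariants (alpha : 'rV[padic_int l]_3) (v := map_mx rho alpha) :
  v != 0 -> mu_invariant alpha = 0%N /\
            lambda_invariant alpha = (first_unit_coef v).-1%:Z.
Proof.
move=> v_neq0; apply: char_series_invariants => [|n6]; last first.
  by have [] := first_unit_coef6 v v_neq0 n6.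
have := first_unit_coef6 v v_neq0; rewrite -/v /first_unit_coef.
case: ifP => [_ _|_]; first exact: leq_trans l_ge5.
case: ifP => [_ _|_ /(_ erefl) [l1 _]]; first exact: leq_trans l_ge5.
(* Index 6 must be below l: the congruence l = 1 mod 3 rules out 5 and 6. *)
move: l1 l_prime; case: (l) l_ge5 => [|[|[|[|[|[|[|?]]]]]]] //.
Qed.

Definition residue_event mu0 (lambda0 : int) : {set 'rV['F_l]_3} :=
  [set v | [&& v != 0, mu0 == 0%N & (first_unit_coef v).-1%:Z == lambda0]].

Definition residue_count mu0 lambda0 := #|residue_event mu0 lambda0|.

(** The normalization (1 - l^-3)^-1 times l^-3 is 1/(l^3 - 1), so the probability is a proportion of
    the nonzero vectors of F_l^3. *)
Lemma prob_invariantsE (R : realType) (tau : probability (padic_borel l 3) R)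
    mu0 lambda0 : is_haar tau ->
  prob_invariants tau mu0 lambda0
    = ((residue_count mu0 lambda0)%:R / (l%:R ^+ 3 - 1))%:E.
Proof.
move=> tau_haar; rewrite /prob_invariants.
have -> : [set alpha | [/\ @admissible l 3 alpha, mu_invariant alpha = mu0
              & lambda_invariant alpha = lambda0]]%classic
    = [set alpha | map_mx rho alpha \in residue_event mu0 lambda0]%classic.
  apply/seteqP; split=> alpha /=; rewrite inE.
    case=> /(admissible_rho l_prime) v_neq0 <- <-.
    by have [-> ->] := bouquet3_invariants alpha v_neq0; rewrite v_neq0 !eqxx.
  case/and3P => v_neq0 /eqP -> /eqP <-.
  by have [-> ->] := bouquet3_invariants alpha v_neq0; split=> //;
    apply/admissible_rho.
rewrite (haar_preimage_residue l_prime) // -EFinM; congr (_%:E).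
have l_gt1 : 1 < l%:R :> R by rewrite ltr1n prime_gt1.
have l_neq0 : l%:R != 0 :> R by rewrite gt_eqF // (lt_trans ltr01).
have l31 : l%:R ^+ 3 - 1 != 0 :> R by rewrite subr_eq0 gt_eqF // exprn_egt1.
rewrite -/(residue_count mu0 lambda0).
by field; rewrite l31.
Qed.

Lemma power_sum0 k : power_sum (0 : 'rV['F_l]_3) k.+1 = 0.
Proof. by rewrite /power_sum big1 // => j _; rewrite mxE expr0n. Qed.

Definition common_zeros :=
  [set v : 'rV['F_l]_3 | [&& v != 0, power_sum v 2 == 0 & power_sum v 4 == 0]].

(** lambda = 1 corresponds to index 2, that is, to the complement of the conic, which contains the
    origin. *)
Lemma residue_count_lambda1 : (residue_count 0 1 + l ^ 2 = l ^ 3)%N.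
Proof.
rewrite -[in (l ^ 2)%N](card_Fp l_prime) -(card_conic _ odd_card_Fp).
have <- : #|{: 'rV['F_l]_3}| = (l ^ 3)%N by rewrite card_mx card_Fp.
rewrite -(cardsC [set v : 'rV['F_l]_3 | power_sum v 2 == 0]) addnC; congr (_ + _)%N.
congr #|pred_of_set _|; apply/finset.setP => v; rewrite !inE /first_unit_coef.
case: (eqVneq (power_sum v 2)) => [_|p2] /=.
  by case: (eqVneq (power_sum v 4)); rewrite andbF.
by rewrite andbT; apply: contraNneq p2 => ->; rewrite power_sum0.
Qed.

(** The conic splits into these vectors, the nonzero common zeros and the origin, which accounts for
    the 1. *)
Lemma residue_count_lambda3 :
  (residue_count 0 3 + #|common_zeros| + 1 = l ^ 2)%N.
Proof.
rewrite -[in (l ^ 2)%N](card_Fp l_prime) -(card_conic _ odd_card_Fp).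
rewrite [RHS](cardsD1 0) inE power_sum0 eqxx addnC; congr (_ + _)%N.
rewrite -[RHS](cardsID common_zeros) addnC; congr (_ + _)%N;
  congr #|pred_of_set _|; apply/finset.setP => v; rewrite !inE /first_unit_coef.
  by case: (eqVneq v) => //= _; case: (eqVneq (power_sum v 2)) => //= _;
   case: (eqVneq (power_sum v 4)).
by case: (eqVneq v) => //= _; case: (eqVneq (power_sum v 2)) => //= _;
   case: (eqVneq (power_sum v 4)).
Qed.

Lemma residue_count_lambda5 : residue_count 0 5 = #|common_zeros|.
Proof.
congr #|pred_of_set _|; apply/finset.setP => v; rewrite !inE /first_unit_coef.
by case: (eqVneq v) => //= _; case: (eqVneq (power_sum v 2)) => //= _;
   case: (eqVneq (power_sum v 4)).
Qed.

Lemma residue_count_eq0 mu0 (lambda0 : int) :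
  ~~ [&& mu0 == 0%N & lambda0 \in [:: 1; 3; 5]] -> residue_count mu0 lambda0 = 0%N.
Proof.
move=> no; apply/eqP; rewrite cards_eq0; apply/eqP/finset.setP => v.
rewrite !inE; apply: contraNF no => /and3P[_ -> /eqP <-] /=.
by rewrite /first_unit_coef; do 2?case: ifP.
Qed.

Lemma card_common_zeros_mod3_1 : (l %% 3 = 1)%N -> #|common_zeros| = (8 * l.-1)%N.
Proof.
move=> l1; rewrite (card_common_zeros _ odd_card_Fp) ?card_Fp //.
exact: three_Fp_neq0.
Qed.

Lemma card_common_zeros_mod3_2 : (l %% 3 = 2)%N -> #|common_zeros| = 0%N.
Proof.
move=> l2; apply/eqP; rewrite cards_eq0; apply/eqP/finset.setP => v.
rewrite !inE; apply/and3P => -[/eqP v_neq0 /eqP p2 /eqP p4]; apply: v_neq0.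
apply: common_zero_trivial => //.
- exact: odd_card_Fp.
- by rewrite card_Fp.
- exact: three_Fp_neq0.
Qed.

End Bouquet3.

(** * From residue counts to probabilities *)

Theorem proposition4p20 (R : realType) (l : nat) (l_prime : prime l)
    (l_ge5 : (5 <= l)%N) (tau : probability (padic_borel l 3) R)
    (tau_haar : is_haar tau) :
  let D : R := l%:R ^+ 2 + l%:R + 1 in
  [/\ prob_invariants tau 0%N 1 = (l%:R ^+ 2 / D)%:E,
      (l = 2 %[mod 3])%N ->
        forall (mu0 : nat) (lambda0 : int),
          prob_invariants tau mu0 lambda0 =
            (if (mu0 == 0%N) && (lambda0 == 1) then l%:R ^+ 2 / D
             else if (mu0 == 0%N) && (lambda0 == 3) then (l%:R + 1) / D
             else 0)%:E
    & (l = 1 %[mod 3])%N ->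
        forall (mu0 : nat) (lambda0 : int),
          prob_invariants tau mu0 lambda0 =
            (if (mu0 == 0%N) && (lambda0 == 1) then l%:R ^+ 2 / D
             else if (mu0 == 0%N) && (lambda0 == 3) then (l%:R - 7) / D
             else if (mu0 == 0%N) && (lambda0 == 5) then 8 / D
             else 0)%:E].
Proof.
set q : R := l%:R => D.
have q_gt1 : 1 < q by rewrite ltr1n prime_gt1.
have q1 : q - 1 != 0 by rewrite subr_eq0 gt_eqF.
have D_neq0 : D != 0 by rewrite gt_eqF // !addr_gt0 ?exprn_gt0 // (lt_trans ltr01).
have qD : q ^+ 3 - 1 = (q - 1) * D by rewrite /D; ring.
(* The events are stable under nonzero scalars, so each count is a multiple of q - 1, which cancels
   against q^3 - 1 = (q - 1) D. *)
have probE mu0 lambda0 (x : R) :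
    (@residue_count l mu0 lambda0)%:R = (q - 1) * x ->
    prob_invariants tau mu0 lambda0 = (x / D)%:E :> \bar R.
  move=> cE; rewrite (prob_invariantsE l_prime l_ge5) // -/q cE qD.
  by rewrite -mulf_div divff ?mul1r.
have lambda1 : prob_invariants tau 0%N 1 = (q ^+ 2 / D)%:E.
  apply: probE.
  have /(congr1 (fun n => n%:R : R)) := residue_count_lambda1 l_prime l_ge5.
  by rewrite natrD !natrX -/q => /(canRL (addrK _)) ->; ring.
have cz := residue_count_lambda3 l_prime l_ge5.
have c3 : (@residue_count l 0 3)%:R = q ^+ 2 - 1 - #|@common_zeros l|%:R :> R.
  by rewrite -natrX -cz !natrD; ring.
have other mu0 (lambda0 : int) : ~~ [&& mu0 == 0%N & lambda0 \in [:: 1; 3; 5]] ->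
    prob_invariants tau mu0 lambda0 = 0%:E.
  move=> no; rewrite -[X in X%:E](mul0r D^-1); apply: probE.
  by rewrite residue_count_eq0 // mulr0.
split=> // [l2|l1] mu0 lambda0.
  have cz0 := card_common_zeros_mod3_2 l_prime l_ge5 l2.
  case: (eqVneq mu0 0%N) => [->|mu_neq0] /=;
  last by apply: other; rewrite negb_and mu_neq0.
  case: (eqVneq lambda0 1) => [->|l_1] //=.
  case: (eqVneq lambda0 3) => [->|l_3] //=.
    by apply: probE; rewrite c3 cz0; ring.
  (* The value 5 is not covered by [other]; here its count vanishes because there are no nonzero
     common zeros. *)
  case: (eqVneq lambda0 5) => [->|l_5].
    rewrite -[X in X%:E](mul0r D^-1); apply: probE.
    by rewrite residue_count_lambda5 cz0 mulr0.
  by apply: other; rewrite !inE (negPf l_1) (negPf l_3) (negPf l_5).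
have cz1 : #|@common_zeros l|%:R = 8 * (q - 1) :> R.
  rewrite card_common_zeros_mod3_1 // natrM; congr (_ * _).
  by rewrite -subn1 natrB // prime_gt0.
case: (eqVneq mu0 0%N) => [->|mu_neq0] /=;
  last by apply: other; rewrite negb_and mu_neq0.
case: (eqVneq lambda0 1) => [->|l_1] //=.
case: (eqVneq lambda0 3) => [->|l_3] //=.
  by apply: probE; rewrite c3 cz1; ring.
case: (eqVneq lambda0 5) => [->|l_5].
  by apply: probE; rewrite residue_count_lambda5 cz1; ring.
by apply: other; rewrite !inE (negPf l_1) (negPf l_3) (negPf l_5).
Qed.
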